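(* Let $G=(V,E)$ be a finite graph and let $N\ge 2$ be an integer. Let $\mathcal N(G;N\mathbb Z)$ be the number of orientations of $G$ in which the out-degree of every vertex is divisible by $N$. Then $$ \mathcal N(G;N\mathbb Z)=\frac{(-1)^{|E|}}{N^{|E|+|V|}}\sum_{f\in\mathcal A_N}\ \prod_{e\in E}\omega_N(f(e))\prod_{v\in V}\left\{\sum_{j\in[N]\setminus\{f(e)\,:\,v\in e\}}\ \prod_{\{e\in E\,:\,v\in e\}}\Big(1-\overline{\omega_N(f(e))}\,\omega_N(j)\Big)\right\}. $$
   Context: An orientation of a graph $G=(V,E)$ is an assignment of a direction to each edge. Write $[N]=\{1,\ldots,N\}$, let $[N]^E$ be the set of all maps $f:E\to[N]$, and let $\omega_N(j)=e^{2\pi \mathrm i j/N}$ for $j\in[N]$, with $\mathrm i=\sqrt{-1}$; the bar denotes complex conjugation. $\mathcal A_N$ is the set of all $f\in[N]^E$ such that $\max_{v\in V}\big|\{f(e): e\in E,\ v\in e\}\big|\le N-1$, i.e. at every vertex at most $N-1$ distinct values of $f$ appear on the incident edges. *)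

(* Defs.v *)
From HB Require Import structures.
From mathcomp Require Import all_boot all_order all_algebra.
From mathcomp Require Import complex.
From mathcomp Require Import reals trigo.

Set Implicit Arguments.
Unset Strict Implicit.
Unset Printing Implicit Defensive.

Import GRing.Theory Num.Theory.
Local Open Scope ring_scope.
Local Open Scope complex_scope.

(* Finite graphs without loops.  Parallel edges are allowed; a simple graph is
   the case where [ends] is injective. *)
Record graph := Graph {
  vertex : finType;
  edge : finType;
  ends : edge -> {set vertex};
  card_ends : forall e, #|ends e| = 2%N }.

Definition incident (G : graph) (v : vertex G) : {set edge G} :=
  [set e | v \in ends e].

(* An edge is directed from [(o e).1] to [(o e).2]; since its two ends are
   distinct, each edge has exactly two possible directions. *)
Definition is_orientation (G : graph)
    (o : {ffun edge G -> vertex G * vertex G}) : bool :=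
  [forall e, ends e == [set (o e).1; (o e).2]].

Definition outdeg (G : graph) (o : {ffun edge G -> vertex G * vertex G})
    (v : vertex G) : nat :=
  #|[set e | (o e).1 == v]|.

Definition num_orientations_dvd (G : graph) (N : nat) : nat :=
  #|[set o : {ffun edge G -> vertex G * vertex G} |
      is_orientation o & [forall v, (N %| outdeg o v)%N]]|.

(* The label set {1, ..., N} is represented by ['I_N], where [j : 'I_N] stands
   for the label [j.+1]. *)
Definition omega (R : realType) (N : nat) (j : 'I_N) : R[i] :=
  let theta : R := 2 * pi * (j.+1)%:R / N%:R in cos theta +i* sin theta.

(* The labels occurring on the edges at [v]. *)
Definition labels_at (G : graph) (N : nat) (f : {ffun edge G -> 'I_N})
    (v : vertex G) : {set 'I_N} :=
  [set f e | e in incident v].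

Definition admissible (G : graph) (N : nat) : {set {ffun edge G -> 'I_N}} :=
  [set f : {ffun edge G -> 'I_N} |
    (\max_(v : vertex G) #|labels_at f v| <= N - 1)%N].

(* Main.v *)
Require Import Defs.
From mathcomp Require Import all_boot all_order all_algebra.
From mathcomp Require Import complex.
From mathcomp Require Import reals trigo.
From mathcomp Require Import ring lra.

Import GRing.Theory Num.Theory.
Local Open Scope ring_scope.
Local Open Scope complex_scope.

(** All sums can be extended by zero terms: the summand of [j] at [v] vanishes
    as soon as [j] occurs on an edge at [v] ([sum_unused_labels]), and a
    labelling [f] with all [N] labels around some vertex has an empty sum as a
    factor ([notin_admissible]).  The right-hand side thus becomes a sum over
    all labellings [f] of the edges and, after expanding the product over the
    vertices, over all labellings [x] of the vertices.

    For fixed [x] the sum over [f] factors over the edges, and since the sums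
    of all N-th roots of unity and of their conjugates vanish, the edge [ab]
    contributes [- N * (omega (x a) + omega (x b))] ([sum_edge_label]).
    Expanding the product over the edges chooses a tail for each edge, so it
    is the generating function of orientations by out-degrees
    ([prod_sum_ends]).  Summing over [x] now factors over the vertices, and
    orthogonality of the characters of Z/N ([sum_omega_exp]) keeps exactly the
    orientations whose out-degrees are all divisible by [N], each with weight
    [N ^+ #|V|].  The outer factor cancels the powers of [N] and the sign. *)

Definition expi (R : realType) (x : R) : R[i] := cos x +i* sin x.

Lemma expi_mulrn (R : realType) (x : R) n : expi R x ^+ n = expi R (x *+ n).
Proof.
elim: n => [|n IHn]; first by rewrite expr0 mulr0n /expi cos0 sin0.
rewrite exprS IHn mulrS /expi cosD sinD.
by apply/eqP; rewrite eq_complex /= eqxx /= addrC.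
Qed.

(** By the double angle formula, [cos x = 1 - 2 sin^2 (x / 2)], and the half
    angle lies strictly between 0 and [pi]. *)
Lemma expi_neq1 (R : realType) (x : R) :
  0 < x < 2 * pi -> expi R x != 1.
Proof.
move=> /andP[x_gt0 x_lt]; rewrite eq_complex /= negb_and; apply/orP; left.
have xE : x = (x / 2) *+ 2 by field.
have s_gt0 : 0 < sin (x / 2) by apply: sin_gt0_pi; apply/andP; split; lra.
have cs := cos2Dsin2 (x / 2).
have c2 := cos_mulr2n (x / 2); rewrite -xE in c2.
have : 0 < sin (x / 2) ^+ 2 by rewrite exprn_gt0.
by move=> s2; apply/eqP => c1; lra.
Qed.

Lemma omegaE (R : realType) N (j : 'I_N) :
  omega R j = expi R (2 * pi / N%:R) ^+ j.+1.
Proof. by rewrite expi_mulrn -[_ * _ *+ _]mulr_natr mulrAC. Qed.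

Lemma expi_prim_root (R : realType) N : (0 < N)%N ->
  N.-primitive_root (expi R (2 * pi / N%:R)).
Proof.
move=> N_gt0; have NR_gt0 : 0 < N%:R :> R by rewrite ltr0n.
apply/andP; split=> //; apply/forallP => i; apply/eqP.
rewrite unity_rootE expi_mulrn; have [->|ltiN] := eqVneq i.+1 N.
  rewrite -[_ * _ *+ _]mulr_natr mulfVK ?lt0r_neq0 // mulr_natl /expi.
  by rewrite cos2pi mulr2n sinDpi sinpi oppr0 eqxx.
apply/negbTE/expi_neq1; have pi0 := pi_gt0 R.
have lt_iN : i.+1%:R < N%:R :> R by rewrite ltr_nat ltn_neqAle ltiN ltn_ord.
rewrite pmulrn_lgt0 // divr_gt0 ?mulr_gt0 //=.
by rewrite -[_ * _ *+ _]mulr_natr mulrAC ltr_pdivrMr // ltr_pM2l ?mulr_gt0.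
Qed.

(** Orthogonality of characters: a geometric sum in [z ^+ d], where [z] is a
    primitive root. *)
Lemma sum_omega_exp (R : realType) N d : (0 < N)%N ->
  \sum_(j < N) omega R j ^+ d = if (N %| d)%N then N%:R else 0.
Proof.
move=> /(expi_prim_root R); set z := expi R _ => prim_z.
(* The factor [z ^+ d] appears because [j] stands for the label [j.+1]. *)
have -> : \sum_(j < N) omega R j ^+ d = z ^+ d * \sum_(j < N) (z ^+ d) ^+ j.
  rewrite big_distrr; apply: eq_bigr => j _.
  by rewrite omegaE -exprM mulnC exprM exprS.
rewrite (prim_order_dvd prim_z); have [->|zd] := eqVneq (z ^+ d) 1.
  rewrite mul1r (eq_bigr (fun=> 1)) => [|j _]; last by rewrite expr1n.
  by rewrite sumr_const card_ord.
apply/eqP; rewrite mulf_eq0; apply/orP; right.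
have /eqP := subrX1 (z ^+ d) N.
rewrite -exprM mulnC exprM (prim_expr_order prim_z) expr1n subrr eq_sym.
by rewrite mulf_eq0 subr_eq0 (negbTE zd).
Qed.

Lemma conj_omegaM (R : realType) N (j : 'I_N) :
  (omega R j)^* * omega R j = 1.
Proof.
rewrite /omega; set t := _ / _.
apply/eqP; rewrite eq_complex /=; apply/andP; split; apply/eqP; last by ring.
by rewrite -(cos2Dsin2 t); ring.
Qed.

Lemma sum_omega (R : realType) N : (1 < N)%N ->
  \sum_(j < N) omega R j = 0.
Proof.
move=> N_gt1; have := sum_omega_exp R N 1 (ltnW N_gt1).
by rewrite dvdn1 gtn_eqF.
Qed.

Lemma big_ends (R : Type) (idx : R) (op : Monoid.com_law idx) (G : graph)
    (e : edge G) (a b : vertex G) (F : vertex G -> R) :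
  a != b -> ends e = [set a; b] ->
  \big[op/idx]_(v in ends e) F v = op (F a) (F b).
Proof. by move=> ab ->; rewrite big_setU1 ?inE //= big_set1. Qed.

(** For ends [a], [b], multiplying out gives [omega k] minus the constant
    [omega (x a) + omega (x b)] plus a multiple of the conjugate of [omega k];
    only the constant survives summation over [k]. *)
Lemma sum_edge_label (R : realType) (G : graph) N (x : vertex G -> 'I_N)
    (e : edge G) : (1 < N)%N ->
  \sum_(k < N) omega R k *
     \prod_(v in ends e) (1 - (omega R k)^* * omega R (x v)) =
  - N%:R * \sum_(v in ends e) omega R (x v).
Proof.
move=> N_gt1; have [a [b [ab eE]]] := cards2P _ (introT eqP (card_ends e)).
rewrite (@big_ends _ _ _ G e a b) //=.
under eq_bigr => k _ do rewrite (@big_ends _ _ _ G e a b) //=.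
set s := omega R (x a); set t := omega R (x b).
transitivity (\sum_(k < N)
  (omega R k - (s + t) + (omega R k)^* * (s * t))).
  apply: eq_bigr => k _; have := conj_omegaM R N k; set c := (omega R k)^*.
  move=> cw.
  have -> : omega R k * ((1 - c * s) * (1 - c * t)) =
    omega R k - (c * omega R k) * (s + t) + c * omega R k * (c * (s * t)).
    by ring.
  by rewrite cw !mul1r.
rewrite !big_split /= -big_distrl /= -rmorph_sum sum_omega // rmorph0.
by rewrite sumr_const card_ord mul0r addr0 add0r mulNrn mulNr mulr_natl.
Qed.

(** The directions of an edge correspond to the choice of its tail. *)
Lemma sum_directions (R : nmodType) (G : graph) (e : edge G)
    (F : vertex G -> R) :
  \sum_(p : vertex G * vertex G | ends e == [set p.1; p.2]) F p.1 =
  \sum_(v in ends e) F v.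
Proof.
have [a [b [ab eE]]] := cards2P _ (introT eqP (card_ends e)).
rewrite (@big_ends _ _ _ G e a b) //=.
rewrite (eq_bigl (mem [set (a, b); (b, a)])) => [|[c d] /=].
  by rewrite big_setU1 ?big_set1 // inE xpair_eqE negb_and ab.
rewrite !inE !xpair_eqE eE; apply/eqP/orP => [abcd|[]/andP[/eqP-> /eqP->]] //.
  have : c \in [set a; b] by rewrite abcd !inE eqxx.
  have : d \in [set a; b] by rewrite abcd !inE eqxx orbT.
  have : a \in [set c; d] by rewrite -abcd !inE eqxx.
  have : b \in [set c; d] by rewrite -abcd !inE eqxx orbT.
  rewrite !inE => /orP[]/eqP hb /orP[]/eqP ha; subst; rewrite ?eqxx in ab *;
    by auto.
by rewrite setUC.
Qed.

(** Each choice of a tail for every edge is an orientation, in which [x v]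
    is picked once for each edge leaving [v]. *)
Lemma prod_sum_ends (R : comPzRingType) (G : graph) (x : vertex G -> R) :
  \prod_e \sum_(v in ends e) x v =
  \sum_(o : {ffun edge G -> vertex G * vertex G} | is_orientation o)
     \prod_v x v ^+ outdeg o v.
Proof.
under eq_bigr => e _ do rewrite -sum_directions.
rewrite bigA_distr_big_dep; apply: eq_big => [o|o _].
  by apply/familyP/forallP.
rewrite (partition_big (fun e => (o e).1) predT) //=.
apply: eq_bigr => v _; rewrite -prodr_const.
by apply: eq_big => [e|e /eqP->]; rewrite ?inE.
Qed.

(** A label that occurs at [v], say on [e], makes the factor of [e] equal
    to [1 - 1]. *)
Lemma sum_unused_labels (R : realType) (G : graph) (N : nat)
    (f : {ffun edge G -> 'I_N}) (v : vertex G) :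
  \sum_(j in ~: labels_at f v)
     \prod_(e in incident v) (1 - (omega R (f e))^* * omega R j) =
  \sum_(j < N)
     \prod_(e in incident v) (1 - (omega R (f e))^* * omega R j).
Proof.
rewrite big_mkcond; apply: eq_bigr => j _; case: ifPn => //.
rewrite inE negbK => /imsetP[e ev ->].
by rewrite (bigD1 e) //= conj_omegaM subrr mul0r.
Qed.

(** At some vertex all [N] labels occur, so the sum there is empty. *)
Lemma notin_admissible (R : realType) (G : graph) (N : nat)
    (f : {ffun edge G -> 'I_N}) : (0 < N)%N -> f \notin admissible G N ->
  \prod_(v : vertex G) \sum_(j in ~: labels_at f v)
     \prod_(e in incident v) (1 - (omega R (f e))^* * omega R j) = 0.
Proof.
move=> N_gt0; rewrite inE => fN.
have [v /= vN] : exists v, ~~ (#|labels_at f v| <= N - 1)%N.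
  by apply/existsP; rewrite -negb_forall; apply: contra fN
    => /forallP fN; apply/bigmax_leqP.
have vT : labels_at f v = setT.
  apply/eqP; rewrite eqEcard subsetT cardsT card_ord.
  by move: vN; rewrite -ltnNge subn1 prednK.
by rewrite (bigD1 v) //= vT setCT big_set0 mul0r.
Qed.

Theorem mainTheorem4 (R : realType) (G : graph) (N : nat) (hN : (2 <= N)%N) :
  (num_orientations_dvd G N)%:R =
    (-1) ^+ #|edge G| / N%:R ^+ (#|edge G| + #|vertex G|) *
    (\sum_(f in admissible G N)
       (\prod_(e : edge G) omega R (f e)) *
       (\prod_(v : vertex G)
          \sum_(j in ~: labels_at f v)
             \prod_(e in incident v)
                (1 - (omega R (f e))^* * omega R j))) :> R[i].
Proof.
have N_gt0 : (0 < N)%N := ltnW hN.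
have N_neq0 : N%:R != 0 :> R[i] by rewrite pnatr_eq0 -lt0n.
set S := \sum_(f in _) _.
suff -> : S = (- N%:R) ^+ #|edge G| *
    (N%:R ^+ #|vertex G| * (num_orientations_dvd G N)%:R).
  have sign2 : (-1) ^+ #|edge G| * (-1) ^+ #|edge G| = 1 :> R[i].
    by rewrite -exprMn mulrNN mulr1 expr1n.
  have := expf_neq0 #|edge G| N_neq0; have := expf_neq0 #|vertex G| N_neq0.
  rewrite [(- N%:R) ^+ _]exprNn exprD; move: sign2.
  move: ((-1) ^+ _) (N%:R ^+ _) (N%:R ^+ _) (num_orientations_dvd _ _)%:R.
  move=> s a b X s2 a0 b0; rewrite -{1}[X]mul1r -s2.
  by field; rewrite b0 a0.
(* Extend both sums by zero terms, then expand the product over the vertices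
   and regroup its factors by edges. *)
transitivity (\sum_(f : {ffun edge G -> 'I_N}) \sum_(x : {ffun vertex G -> 'I_N})
   \prod_e (omega R (f e) *
     \prod_(v in ends e) (1 - (omega R (f e))^* * omega R (x v)))).
  rewrite /S big_mkcond; apply: eq_bigr => f _.
  transitivity ((\prod_e omega R (f e)) * (\prod_v \sum_(j in ~: labels_at f v)
     \prod_(e in incident v) (1 - (omega R (f e))^* * omega R j))).
    by case: ifPn => // /(notin_admissible R G N f N_gt0)->; rewrite mulr0.
  under [X in _ * X]eq_bigr => v _ do rewrite sum_unused_labels.
  rewrite bigA_distr_bigA big_distrr; apply: eq_bigr => x _ /=.
  rewrite big_split /=; congr (_ * _).
  rewrite (exchange_big_dep predT) //=; apply: eq_bigr => e _.
  by apply: eq_bigl => v; rewrite inE.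
rewrite exchange_big /=.
transitivity (\sum_(x : {ffun vertex G -> 'I_N}) (- N%:R) ^+ #|edge G| *
   \prod_(e : edge G) \sum_(v in ends e) omega R (x v)).
  apply: eq_bigr => x _.
  rewrite -(bigA_distr_bigA (fun e k => omega R k *
    \prod_(v in ends e) (1 - (omega R k)^* * omega R (x v)))).
  under eq_bigr => e _ do rewrite sum_edge_label //.
  by rewrite big_split /= prodr_const.
rewrite -big_distrr /=; congr (_ * _).
under eq_bigr => x _ do rewrite prod_sum_ends.
rewrite exchange_big /=.
under eq_bigr => o _.
  rewrite -(bigA_distr_bigA (fun v j => omega R j ^+ outdeg o v)).
  under eq_bigr => v _ do rewrite sum_omega_exp //.
  over.
rewrite -[num_orientations_dvd G N]sum1_card natr_sum big_distrr /=.
rewrite big_mkcond [RHS]big_mkcond; apply: eq_bigr => o _; rewrite inE.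
case: ifP => //= _; case: ifPn => [/forallP dv|].
  under eq_bigr => v _ do rewrite dv.
  by rewrite prodr_const mulr1.
rewrite negb_forall => /existsP[v /negbTE nv].
by rewrite (bigD1 v) //= nv mul0r.
Qed.
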